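(* Let $G'$ be a connected graph on $n$ nodes and let $G$ be a bipartite subgraph of $G'$ with bipartitions $L$ and $R$, such that $|R|\ge|L|=m$ and $G$ has a matching of size $m$. Assume all uninformed neighbors in $G'$ of nodes in $L$ are in $R$. Let $\Delta$ be the maximum degree of $G$ and fix an integer $r$ with $1\le r\le\log\Delta$. Consider an $r$-round execution of PPUSH in $G'$ (static during these rounds) in which the nodes in $L$ start with the rumor and the nodes in $R$ do not. Then with constant probability, at least $\Omega\big(\frac{m\Delta^{-1/r}}{r\log n}\big)$ nodes in $R$ learn the rumor.
   Context: Mobile telephone model with tag length $b=1$: in each round, each node first publishes a 1-bit tag visible to all its neighbors; then each node may send a connection proposal to at most one neighbor; a node that sends a proposal cannot receive one; a node that sent no proposal and received at least one accepts at most one (possibly chosen adversarially); connected pairs exchange unbounded information. PPUSH: at the start of each round each node advertises via its tag whether it is informed (knows the rumor); each informed node with at least one uninformed neighbor chooses an uninformed neighbor uniformly at random and proposes a connection to send it the rumor. ''With constant probability'' means with probability at least some absolute constant $p>0$.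
   Formalization: G is required to contain every edge of G' between L and R (for an arbitrary bipartite subgraph the claim fails), and a node that sent no proposal and received some must accept exactly one of them. *)

(* Defs.v *)
From HB Require Import structures.
From mathcomp Require Import all_boot all_order all_algebra.
From mathcomp Require Import reals exp.

Set Implicit Arguments.
Unset Strict Implicit.
Unset Printing Implicit Defensive.
Import Order.TTheory GRing.Theory Num.Theory.
Local Open Scope ring_scope.

Section Graphs.
Variable T : finType.
Implicit Types (e : rel T) (A B : {set T}).

Definition simple_graph e : Prop := symmetric e /\ irreflexive e.

Definition connected_graph e : Prop := forall x y, connect e x y.

Definition neighbors e (x : T) : {set T} := [set y | e x y].

Definition max_degree e : nat := \max_(x : T) #|neighbors e x|.

Definition bipartition e A B : Prop :=
  [disjoint A & B] /\
  (forall x y, e x y -> (x \in A) && (y \in B) || (x \in B) && (y \in A)).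

(* [e] is the bipartite subgraph of [e'] with parts [A] and [B]: its edges are
   all the edges of [e'] running between [A] and [B]. *)
Definition bipartite_subgraph e e' A B : Prop :=
  [/\ simple_graph e, bipartition e A B, subrel e e' &
      forall x y, x \in A -> y \in B -> e' x y -> e x y].

Definition matching e (M : {set {set T}}) : Prop :=
  (forall E, E \in M -> exists x y, e x y /\ E = [set x; y]) /\ trivIset M.

End Graphs.

Section MobileTelephone.
Variable T : finType.

(* [f u = Some v]: [u] proposes a connection to [v];
   [f u = None]: [u] sends no proposal. *)
Definition proposals := {ffun T -> option T}.

(* Proposals of the rounds played so far, most recent round first. *)
Definition history := seq proposals.

Definition can_accept (f : proposals) (v : T) : bool :=
  (f v == None) && [exists u, f u == Some v].

(* [a v = Some u]: [v] accepts the proposal of [u]. A node able to accept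
   accepts exactly one of the proposals it received. *)
Definition legal_acceptance (f : proposals) (a : T -> option T) : Prop :=
  forall v, if can_accept f v then exists2 u, a v = Some u & f u = Some v
            else a v = None.

(* The accepted proposals of a round are chosen by an adaptive adversary that
   sees the whole past and the proposals of the current round, the latter being
   the head of the history. *)
Definition adversary := history -> T -> option T.

Definition legal_adversary (adv : adversary) : Prop :=
  forall f h, legal_acceptance f (adv (f :: h)).

Definition exchange (I : {set T}) (a : T -> option T) : {set T} :=
  I :|: [set v | [exists u in I, (a v == Some u) || (a u == Some v)]].

End MobileTelephone.

Section PPUSH.
Variables (K : realType) (T : finType) (e : rel T).

Definition ppush_tag (I : {set T}) (v : T) : bool := v \in I.

Definition ppush_targets (I : {set T}) (u : T) : {set T} :=
  [set v in neighbors e u | ~~ ppush_tag I v].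

Definition ppush_node_law (I : {set T}) (u : T) (o : option T) : K :=
  if (u \in I) && (ppush_targets I u != set0) then
    if o is Some v then (v \in ppush_targets I u)%:R / #|ppush_targets I u|%:R
    else 0
  else (o == None)%:R.

(* Distinct nodes make their random choices independently. *)
Definition ppush_round_law (I : {set T}) (f : proposals T) : K :=
  \prod_u ppush_node_law I u (f u).

Variables (adv : adversary T) (I0 : {set T}).

Fixpoint informed (h : history T) : {set T} :=
  if h is _ :: h' then exchange (informed h') (adv h) else I0.

Fixpoint ppush_law (h : history T) : K :=
  if h is f :: h' then ppush_law h' * ppush_round_law (informed h') f else 1.

Definition ppush_prob (r : nat) (E : pred (history T)) : K :=
  \sum_(h : r.-tuple (proposals T) | E h) ppush_law h.

Lemma ppush_node_law_ge0 I u o : 0 <= ppush_node_law I u o.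
Proof.
rewrite /ppush_node_law; case: ifP => _; last exact: ler0n.
by case: o => // v; rewrite divr_ge0 ?ler0n.
Qed.

Lemma ppush_node_law_sum I u : \sum_o ppush_node_law I u o = 1.
Proof.
rewrite /ppush_node_law; case: (boolP ((u \in I) && _)) => [/andP[_ N0]|_]; last first.
  by rewrite (bigD1 None) //= big1 ?addr0 // => o /negbTE ->.
rewrite (bigD1 None) //= add0r (reindex_omap (P := fun o => o != None) (@Some T) id) /=; last by case.
rewrite (eq_bigl xpredT) => [|v]; last by rewrite eqxx.
rewrite -mulr_suml -natr_sum -big_mkcond sum1_card divff //.
by rewrite pnatr_eq0 cards_eq0.
Qed.

Lemma ppush_law_ge0 h : 0 <= ppush_law h.
Proof.
elim: h => //= f h IH; rewrite mulr_ge0 // prodr_ge0 // => u _.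
exact: ppush_node_law_ge0.
Qed.

Lemma ppush_prob_total r : ppush_prob r xpredT = 1.
Proof.
rewrite /ppush_prob; elim: r => [|r IH].
  rewrite (bigD1 [tuple]) //= big1 ?addr0 // => h hN0.
  by rewrite [h]tuple0 in hN0.
rewrite (reindex (fun p : r.-tuple (proposals T) * proposals T =>
                    [tuple of p.2 :: p.1])) /=; last first.
  exists (fun h : r.+1.-tuple (proposals T) => ([tuple of behead h], thead h)) => [[h f] _|h _].
    by congr (_, _); apply: val_inj.
  by rewrite /= [RHS]tuple_eta.
rewrite -(pair_bigA _ (fun (h : r.-tuple _) f =>
  ppush_law h * ppush_round_law (informed h) f)) /= -IH.
apply: eq_bigr => h _; rewrite -mulr_sumr.
rewrite -[RHS]mulr1; congr (_ * _).
rewrite /ppush_round_law -(bigA_distr_bigA (ppush_node_law (informed h))).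
by rewrite big1 // => u _; apply: ppush_node_law_sum.
Qed.

End PPUSH.

Definition log2 (K : realType) (x : K) : K := ln x / ln 2.

(* Main.v *)
(* Let q = Delta^(-1/r). Proposals to uninformed nodes are always successful
   (an uninformed node sends none, so it accepts one of those it receives),
   whatever the adversary does. Call u in L slow in a round if at least a
   fraction q of its uninformed neighbours stay uninformed in that round. A node
   of L that is never slow ends with fewer than q^r Delta = 1 uninformed
   neighbours, so its partner in the matching is informed: writing S for the
   number of informed nodes of R and N for the number of slow (node, round)
   pairs, m <= S + N surely. Exposing the choices of one round node by node, a
   slow node hits a node not reached before with probability at least q, so
   (1/2)^S (1 - q/2)^(-N) is a supermartingale. It is at least 2 if
   S < m q / 12 and m q / 12 > 1, which by Markov's inequality has probability
   at most 1/2; if m q / 12 <= 1, it suffices that S >= 1, which is sure.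
   Since r log n >= 1, this is stronger than needed. *)
Require Import Defs.
From mathcomp Require Import all_boot all_order all_algebra.
From mathcomp Require Import reals exp.
From mathcomp Require Import ring lra.
Set Implicit Arguments.
Unset Strict Implicit.
Unset Printing Implicit Defensive.
Import Order.TTheory GRing.Theory Num.Theory.
Local Open Scope ring_scope.

(** * Resampling one coordinate of a product law *)

Section ProductLaw.
Variables (K : comPzSemiRingType) (T S : finType) (P : T -> S -> K).

Definition update (f : {ffun T -> S}) (u : T) (o : S) : {ffun T -> S} :=
  [ffun v => if v == u then o else f v].

(** Swapping the coordinate at [u] with an independent sample from [P u] is an involution that
    preserves the joint law; this lets one node's choice be averaged with all others fixed. *)
Lemma resample (u : T) (F : {ffun T -> S} -> K) : \sum_o P u o = 1 ->
  \sum_(f : {ffun T -> S}) (\prod_v P v (f v)) * F f =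
  \sum_(f : {ffun T -> S}) (\prod_v P v (f v)) * \sum_o P u o * F (update f u o).
Proof.
move=> Pu1; symmetry.
under eq_bigr => f _ do rewrite mulr_sumr.
rewrite pair_bigA /=.
pose swap (p : {ffun T -> S} * S) := (update p.1 u p.2, p.1 u).
have swapK : involutive swap.
  move=> [f o]; rewrite /swap /= ffunE eqxx; congr (_, _).
  by apply/ffunP => v; rewrite !ffunE; case: eqP => // ->.
rewrite (reindex_inj (inv_inj swapK)) /=.
transitivity (\sum_(p : {ffun T -> S} * S) (\prod_v P v (p.1 v)) * F p.1 * P u p.2).
  apply: eq_bigr => -[f o] _ /=; have := swapK (f, o); rewrite /swap /= => -[-> _].
  rewrite (bigD1 u) //= [in RHS](bigD1 u) //= ffunE eqxx.
  rewrite (eq_bigr (fun v => P v (f v))) => [|v /negbTE vu]; last by rewrite ffunE vu.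
  by ring.
rewrite -(pair_bigA _ (fun (f : {ffun T -> S}) o => (\prod_v P v (f v)) * F f * P u o)) /=.
by apply: eq_bigr => f _; rewrite -mulr_sumr Pu1 mulr1.
Qed.

End ProductLaw.

(** The block map [pblock M] sends [X] onto a set containing [M]. *)
Lemma trivIset_card_le (T : finType) (M : {set {set T}}) (X : {set T}) :
  trivIset M -> (forall E, E \in M -> exists2 x, x \in E & x \in X) ->
  (#|M| <= #|X|)%N.
Proof.
move=> tiM meetX; apply: leq_trans (leq_imset_card (pblock M) X).
apply/subset_leq_card/subsetP => E EM; have [x xE xX] := meetX E EM.
by apply/imsetP; exists x => //; rewrite (def_pblock tiM EM xE).
Qed.

(** * Exposure of the choices within one round *)

Section Round.
Variables (K : realType) (T : finType) (e : rel T) (I : {set T}) (q : K).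
Hypotheses (q0 : 0 <= q) (q1 : q <= 1).
Implicit Types (f : proposals T) (s : seq T) (A B : {set T}) (u v : T).

Definition boost : K := (1 - q / 2)^-1.

Lemma boost_ge : 1 + q / 2 <= boost.
Proof.
rewrite /boost -[leRHS]mul1r ler_pdivlMr; last by move: q1; lra.
by move: (sqr_ge0 q); rewrite expr2; lra.
Qed.

Lemma boost_ge1 : 1 <= boost.
Proof. by apply: le_trans boost_ge; move: q0; lra. Qed.

Lemma boost_ge0 : 0 <= boost.
Proof. exact: le_trans ler01 boost_ge1. Qed.

(* [A] stands for the informed set at the end of a round started from [I]. *)
Definition slow A u : bool :=
  (0 < #|ppush_targets e I u|)%N &&
  (q * #|ppush_targets e I u|%:R <= #|ppush_targets e A u|%:R).

Lemma ppush_targetsS A B u : A \subset B -> ppush_targets e B u \subset ppush_targets e A u.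
Proof.
move=> /subsetP AB; apply/subsetP => v; rewrite !inE /ppush_tag => /andP[-> /=].
exact/contra/AB.
Qed.

Lemma slowS A B u : A \subset B -> slow B u -> slow A u.
Proof.
move=> AB /andP[d0 dB]; rewrite /slow d0 (le_trans dB) // ler_nat.
exact/subset_leq_card/ppush_targetsS.
Qed.

(* The nodes of [s] make their choices from right to left: those of the tail are
   exposed before that of the head. *)
Fixpoint reached s f : {set T} :=
  if s is u :: s' then
    if f u is Some v then v |: reached s' f else reached s' f
  else I.

Definition fresh u s f : bool := if f u is Some v then v \notin reached s f else false.

(** Slowness is tested against the set reached before [u] chooses, so the power of [boost] is
    already fixed when the choice of [u] is drawn. *)
Fixpoint weight s f : K :=
  if s is u :: s' then
    weight s' f * (2^-1 ^+ fresh u s' f * boost ^+ slow (reached s' f) u)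
  else 1.

Lemma sub_reached s f : I \subset reached s f.
Proof.
elim: s => //= u s IH; case: (f u) => // v.
exact: subset_trans IH (subsetUr _ _).
Qed.

Lemma mem_reached s f v : v \in reached s f ->
  v \in I \/ exists2 u, u \in s & f u = Some v.
Proof.
elim: s => /= [|u s IH]; first by left.
have {}IH : v \in reached s f -> v \in I \/ exists2 x, x \in u :: s & f x = Some v.
  by move=> /IH[?|[x xs fx]]; [left|right; exists x => //; rewrite inE xs orbT].
case fu: (f u) => [w|] //; rewrite inE => /orP[|//].
by rewrite inE => /eqP ->; right; exists u; rewrite ?inE ?eqxx.
Qed.

Lemma reached_update s f u o : u \notin s -> reached s (update f u o) = reached s f.
Proof.
elim: s => //= w s IH; rewrite inE negb_or => /andP[uw us].
by rewrite ffunE eq_sym (negbTE uw) IH.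
Qed.

Lemma weight_update s f u o : u \notin s -> weight s (update f u o) = weight s f.
Proof.
elim: s => //= w s IH; rewrite inE negb_or => /andP[uw us].
by rewrite /fresh ffunE eq_sym (negbTE uw) !reached_update // IH.
Qed.

Lemma weight_ge0 s f : 0 <= weight s f.
Proof.
elim: s => [|u s IH] /=; first exact: ler01.
by rewrite !mulr_ge0 ?exprn_ge0 ?boost_ge0 ?invr_ge0 ?ler0n.
Qed.

(** Each fresh choice adds exactly one node to the reached set. Slowness is antitone in the informed
    set, so a node slow with respect to [A] was already slow at its exposure, and [boost] is at
    least 1. *)
Lemma weight_ge s f A : reached s f \subset A ->
  2^-1 ^+ #|reached s f :\: I| * boost ^+ count (slow A) s <= weight s f.
Proof.
elim: s => [|u s IH] /= sA; first by rewrite setDv cards0 mulr1.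
have sA' : reached s f \subset A.
  by case: (f u) sA => // v; apply: subset_trans; apply: subsetUr.
have -> : #|(if f u is Some v then v |: reached s f else reached s f) :\: I|
    = (fresh u s f + #|reached s f :\: I|)%N.
  rewrite /fresh; case: (f u) => // v.
  case: (boolP (v \in reached s f)) => vr /=.
    by rewrite (setUidPr _) // sub1set.
  have vI : v \notin I by apply: contra vr; apply: (subsetP (sub_reached s f) v).
  rewrite setDUl (setDidPl _) ?cardsU1 ?inE ?(negbTE vr) ?andbF //.
  by rewrite disjoints1.
rewrite !exprD mulrACA mulrC ler_pM ?IH //.
- by rewrite mulr_ge0 ?exprn_ge0 ?boost_ge0 ?invr_ge0 ?ler0n.
- by rewrite mulr_ge0 ?exprn_ge0 ?boost_ge0 ?invr_ge0 ?ler0n.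
- rewrite ler_wpM2l ?exprn_ge0 ?invr_ge0 //.
  apply: ler_weXn2l; first exact: boost_ge1.
  case: (boolP (slow A u)) => // /(slowS sA') ->.
  by [].
Qed.

(** If a fraction x of the targets of [u] lies outside [A], the power of 2^-1 averages to 1 - x/2;
    slowness means x >= q, and [boost] is the inverse of 1 - q/2. *)
Lemma fresh_bound u A : u \in I -> I \subset A ->
  \sum_o ppush_node_law K e I u o *
    (2^-1 ^+ (if o is Some v then v \notin A else false) * boost ^+ slow A u) <= 1.
Proof.
move=> uI IA; rewrite /ppush_node_law uI /=.
set D := ppush_targets e I u; case: (eqVneq D set0) => [D0|DN0] /=.
  rewrite (bigD1 None) //= big1 ?addr0 => [|o /negbTE ->]; last by rewrite mul0r.
  (* Without targets [slow] is false by its positivity clause, so no boost is paid. *)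
  by rewrite /slow -/D D0 cards0 /= !mulr1.
rewrite (bigD1 None) //= mul0r add0r.
rewrite (reindex_omap (P := fun o => o != None) (@Some T) id) /=; last by case.
rewrite (eq_bigl xpredT) => [|v]; last by rewrite eqxx.
have d0 : 0 < #|D|%:R :> K by rewrite ltr0n card_gt0.
have DA : ppush_targets e A u = D :\: A.
  apply/setP => v; rewrite !inE /ppush_tag; case: (boolP (v \in A)) => vA; rewrite ?andbF //=.
  by rewrite (contra (subsetP IA v) vA).
have -> : \sum_v (v \in D)%:R / #|D|%:R * (2^-1 ^+ (v \notin A) * boost ^+ slow A u)
    = (1 - #|ppush_targets e A u|%:R / #|D|%:R / 2) * boost ^+ slow A u.
  under eq_bigr do rewrite mulrA.
  rewrite -mulr_suml; congr (_ * _).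
  transitivity (\sum_v ((v \in D)%:R / #|D|%:R - (v \in D :\: A)%:R / #|D|%:R / 2 : K)).
    apply: eq_bigr => v _; rewrite in_setD.
    by case: (v \in D); case: (v \in A); rewrite /= ?expr0 ?expr1; generalize (#|D|%:R^-1 : K) => z; lra.
  rewrite sumrB -!mulr_suml -!natr_sum -!big_mkcond !sum1_card DA.
  by rewrite divff ?gt_eqF.
set x := _ / #|D|%:R.
have x0 : 0 <= x by rewrite divr_ge0.
have -> : slow A u = (q <= x) by rewrite ler_pdivlMr // /slow -/D card_gt0 DN0.
case: (leP q x) => [qx|_] /=; last by move: x0; rewrite expr0; lra.
rewrite expr1 /boost ler_pdivrMr; last by move: q1; lra.
by move: qx; lra.
Qed.

(** Averaging over the head [u] leaves the weight of the tail untouched, since [u] does not occur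
    there; induction then peels the nodes off. *)
Lemma weight_expectation s : uniq s -> {subset s <= I} ->
  \sum_(f : proposals T) ppush_round_law K e I f * weight s f <= 1.
Proof.
rewrite /ppush_round_law; elim: s => [|u s IH] /=.
  move=> _ _; under eq_bigr do rewrite mulr1.
  rewrite -(bigA_distr_bigA (ppush_node_law K e I)).
  by rewrite big1 // => u _; apply: ppush_node_law_sum.
move=> /andP[us s_uniq] sI; rewrite (resample (u := u)) ?ppush_node_law_sum //.
apply: le_trans (IH s_uniq _); last by move=> v vs; apply: sI; rewrite inE vs orbT.
apply: ler_sum => f _; rewrite ler_wpM2l //.
  by rewrite prodr_ge0 // => v _; apply: ppush_node_law_ge0.
have -> : \sum_o ppush_node_law K e I u o * (weight s (update f u o) *
      (2^-1 ^+ fresh u s (update f u o) * boost ^+ slow (reached s (update f u o)) u))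
   = weight s f * \sum_o ppush_node_law K e I u o *
    (2^-1 ^+ (if o is Some v then v \notin reached s f else false) * boost ^+ slow (reached s f) u).
  rewrite mulr_sumr; apply: eq_bigr => o _.
  rewrite weight_update // reached_update // mulrCA; congr (_ * (_ * (_ * _))).
  by rewrite /fresh ffunE eqxx; case: o => // v; rewrite reached_update.
rewrite -[leRHS]mulr1 ler_wpM2l ?weight_ge0 //.
by rewrite fresh_bound ?sub_reached // sI // inE eqxx.
Qed.

End Round.

(** * The supermartingale over all rounds, and the matching *)

Section Process.
Variables (K : realType) (T : finType) (e : rel T) (L R I0 : {set T}).
Variables (adv : adversary T) (q : K).
Hypotheses (q0 : 0 <= q) (q1 : q <= 1).
Hypotheses (LI0 : L \subset I0) (RI0 : [disjoint R & I0]).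
Hypothesis LR : forall x y, x \in L -> e x y -> y \notin I0 -> y \in R.
Hypothesis adv_legal : legal_adversary adv.
Implicit Types (h : history T) (f : proposals T).

Local Notation informed := (informed adv I0).
Local Notation law := (ppush_law K e adv I0).

Lemma I0_informed h : I0 \subset informed h.
Proof. by elim: h => //= f h IH; apply: subset_trans IH (subsetUl _ _). Qed.

Lemma ppush_node_law_neq0 I u o : ppush_node_law K e I u o != 0 ->
  if (u \in I) && (ppush_targets e I u != set0)
  then exists2 v, o = Some v & v \in ppush_targets e I u else o = None.
Proof.
rewrite /ppush_node_law; case: ifP => _; last first.
  by case: o => //= v; rewrite eqxx.
case: o => [v|]; last by rewrite eqxx.
by case: (boolP (v \in _)) => vD; [exists v | rewrite mul0r eqxx].
Qed.

(** A node hit by a proposal was uninformed, hence sends none and must accept one; every proposer is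
    informed, so the adversary's pick does not matter. *)
Lemma reached_informed s f h : ppush_round_law K e (informed h) f != 0 ->
  reached (informed h) s f \subset informed (f :: h).
Proof.
move=> /prodf_neq0 fN0; have {}fN0 u := ppush_node_law_neq0 (fN0 u isT).
apply/subsetP => v /mem_reached[vI|[u _ fu]]; first by rewrite inE vI.
case: (boolP (v \in informed h)) => vI; first by rewrite inE vI.
have fv : f v = None by have := fN0 v; rewrite (negbTE vI).
have := adv_legal f h v; rewrite /can_accept fv eqxx /=.
rewrite (introT existsP) => [[w av fw]|]; last by exists u; apply/eqP.
rewrite !inE; apply/orP; right; apply/existsP; exists w; rewrite av eqxx andbT.
by have := fN0 w; rewrite fw; case: (w \in informed h).
Qed.

Lemma reached_sub s f h : {subset s <= L} -> ppush_round_law K e (informed h) f != 0 ->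
  reached (informed h) s f :\: informed h \subset R.
Proof.
move=> sL /prodf_neq0 fN0; have {}fN0 u := ppush_node_law_neq0 (fN0 u isT).
apply/subsetP => v /setDP[/mem_reached[->//|[u us fu]] vI].
have := fN0 u; case: ifP => _; rewrite fu // => -[_ [<-]].
rewrite !inE => /andP[euv _]; apply: LR euv _; first exact: sL.
exact: contra (subsetP (I0_informed h) v) vI.
Qed.

Fixpoint slow_count h : nat :=
  if h is f :: h' then
    (slow_count h' + count (slow e (informed h') q (informed h)) (enum L))%N
  else 0%N.

Definition potential h : K :=
  2^-1 ^+ #|R :&: informed h| * boost q ^+ slow_count h.

Lemma potential_ge0 h : 0 <= potential h.
Proof. by rewrite mulr_ge0 ?exprn_ge0 ?boost_ge0 ?invr_ge0 ?ler0n. Qed.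

(** Nodes newly reached from [L] lie in [R] and get informed; further nodes of [R] informed from
    elsewhere only lower the power of 2^-1. *)
Lemma potential_cons f h : ppush_round_law K e (informed h) f != 0 ->
  potential (f :: h) <= potential h * weight e (informed h) q (enum L) f.
Proof.
move=> fN0; have sL : {subset enum L <= L} by move=> u; rewrite mem_enum.
rewrite /potential /=.
set A := exchange _ _; set I := Defs.informed adv I0 h.
have -> : R :&: A = (R :&: I) :|: (R :&: (A :\: I)).
  by rewrite -setIUr setDE setUIr setUCr setIT (setUidPr _) // subsetUl.
have -> : #|(R :&: I) :|: (R :&: (A :\: I))| = (#|R :&: I| + #|R :&: (A :\: I)|)%N.
  rewrite cardsU [X in (_ - X)%N](_ : _ = 0%N) ?subn0 //; apply/eqP.
  rewrite cards_eq0; apply/eqP/setP => v; rewrite !inE.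
  by case: (v \in I); rewrite ?andbF.
rewrite !exprD mulrACA ler_wpM2l ?potential_ge0 //.
apply: le_trans (weight_ge _ q0 q1 (reached_informed _ fN0)).
rewrite ler_wpM2r ?exprn_ge0 ?boost_ge0 //.
rewrite ler_wiXn2l ?invr_ge0 ?ler0n ?invf_le1 ?ler1n //.
apply/subset_leq_card; rewrite subsetI reached_sub //=.
exact/setSD/reached_informed.
Qed.

Lemma potential_step h :
  \sum_(f : proposals T) ppush_round_law K e (informed h) f * potential (f :: h) <= potential h.
Proof.
apply: (@le_trans _ _ (potential h *
   \sum_(f : proposals T) ppush_round_law K e (informed h) f * weight e (informed h) q (enum L) f)).
  rewrite mulr_sumr; apply: ler_sum => f _; rewrite [leRHS]mulrCA.
  have [->|fN0] := eqVneq (ppush_round_law K e (informed h) f) 0; first by rewrite !mul0r.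
  rewrite ler_wpM2l ?potential_cons //.
  by rewrite prodr_ge0 // => v _; apply: ppush_node_law_ge0.
rewrite -[leRHS]mulr1 ler_wpM2l ?potential_ge0 // weight_expectation ?enum_uniq //.
by move=> u; rewrite mem_enum => uL; rewrite (subsetP (I0_informed h)) // (subsetP LI0).
Qed.

Lemma potential_expectation r :
  \sum_(h : r.-tuple (proposals T)) law h * potential h <= 1.
Proof.
elim: r => [|r IH].
  rewrite (bigD1 [tuple]) //= big1 => [|h]; last by move: (tuple0 h) => -> /eqP[].
  rewrite addr0.
  by rewrite /potential /= (disjoint_setI0 RI0) cards0 !mulr1.
rewrite (reindex (fun p : r.-tuple (proposals T) * proposals T =>
                    [tuple of p.2 :: p.1])) /=; last first.
  exists (fun h : r.+1.-tuple (proposals T) => ([tuple of behead h], thead h)) => [[h f] _|h _].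
    by congr (_, _); apply: val_inj.
  by rewrite /= [RHS]tuple_eta.
rewrite -(pair_bigA _ (fun (h : r.-tuple _) f =>
  law h * ppush_round_law K e (informed h) f * potential (f :: h))) /=.
apply: le_trans IH; apply: ler_sum => h _.
under eq_bigr do rewrite -mulrA.
by rewrite -mulr_sumr ler_wpM2l ?potential_step // ppush_law_ge0.
Qed.

Fixpoint ever_slow h : {set T} :=
  if h is f :: h' then
    [set u in L | slow e (informed h') q (informed h) u] :|: ever_slow h'
  else set0.

Lemma card_ever_slow h : (#|ever_slow h| <= slow_count h)%N.
Proof.
elim: h => [|f h IH]; first by rewrite cards0.
apply: leq_trans (leq_card_setU _ _) _; rewrite addnC leq_add //=.
rewrite -size_filter cardE /enum_mem -filter_predI.
apply: eq_leq; congr size; apply: eq_filter => u.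
by rewrite !inE andbC.
Qed.

(** The comparison is weak only for the empty history; a non-slow round makes it strict, so that an
    upper bound of 1 will leave no target. Targets only shrink, so if some remain at the end, some
    were present in every round. *)
Lemma targets_shrink h u : u \in L -> u \notin ever_slow h ->
  (0 < #|ppush_targets e (informed h) u|)%N ->
  #|ppush_targets e (informed h) u|%:R
    < q ^+ size h * #|ppush_targets e I0 u|%:R ?<= if nilp h.
Proof.
move=> uL; elim: h => [|f h IH] /=; first by rewrite mul1r lexx.
rewrite !inE uL negb_or /=.
set A := exchange _ _ => /andP[notslow slowh] dA.
have hA : (#|ppush_targets e A u| <= #|ppush_targets e (informed h) u|)%N.
  by apply/subset_leq_card/ppush_targetsS/subsetUl.
have dI : (0 < #|ppush_targets e (informed h) u|)%N by apply: leq_trans hA.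
have /= := IH slowh dI; move/lteifW => le_dI.
move: notslow; rewrite /slow dI -ltNge => lt_dA.
apply: lt_le_trans lt_dA _; by rewrite exprS -mulrA ler_wpM2l.
Qed.

Lemma slow_or_informed h u v : u \in L -> v \in R -> e u v -> (0 < size h)%N ->
  q ^+ size h * #|ppush_targets e I0 u|%:R <= 1 ->
  (v \in informed h) || (u \in ever_slow h).
Proof.
move=> uL vR euv h0 qh; apply/norP => -[vI us].
have d0 : (0 < #|ppush_targets e (informed h) u|)%N.
  by apply/card_gt0P; exists v; rewrite !inE euv.
have := targets_shrink uL us d0; rewrite /nilp eqn0Ngt h0 /= => lt_d.
by have := lt_le_trans lt_d qh; rewrite ltNge ler1n d0.
Qed.

(** Either [v] is informed before the last round, or [u] then has an uninformed neighbor and the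
    node it proposes to gets informed. *)
Lemma some_informed h u v : u \in L -> v \in R -> e u v -> (0 < size h)%N ->
  law h != 0 -> (0 < #|R :&: informed h|)%N.
Proof.
case: h => // f h uL vR euv _; rewrite mulf_eq0 negb_or => /andP[_ fN0].
have sub := reached_informed [:: u] fN0.
case: (boolP (v \in informed h)) => vI.
  by apply/card_gt0P; exists v; rewrite !inE vR vI.
have uI : u \in informed h by rewrite (subsetP (I0_informed h)) // (subsetP LI0).
have := fN0 => /prodf_neq0 /(_ u isT) /ppush_node_law_neq0; rewrite uI /=.
rewrite ifT; last by apply/set0Pn; exists v; rewrite !inE euv.
move=> [w fu]; rewrite !inE => /andP[euw wI]; apply/card_gt0P; exists w.
rewrite inE (subsetP sub) ?andbT; last by rewrite /= fu !inE eqxx.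
by apply: LR uL euw _; apply: contra wI => /(subsetP (I0_informed h)).
Qed.

(** Each edge has its end in [R] informed or its end in [L] slow at some time, and disjoint edges
    give distinct ends. *)
Lemma matching_bound h (M : {set {set T}}) : trivIset M ->
  (forall E, E \in M -> exists u v, [/\ u \in L, v \in R, e u v & E = [set u; v]]) ->
  (0 < size h)%N ->
  (forall u, u \in L -> q ^+ size h * #|ppush_targets e I0 u|%:R <= 1) ->
  (#|M| <= #|R :&: informed h| + slow_count h)%N.
Proof.
move=> tiM edgeM h0 qh.
apply: leq_trans (leq_add (leqnn _) (card_ever_slow h)).
apply: leq_trans (leq_card_setU _ _).
apply: trivIset_card_le => // E /edgeM[u [v [uL vR euv ->]]].
have /orP[vI|us] := slow_or_informed uL vR euv h0 (qh u uL).
  by exists v; rewrite !inE ?eqxx ?orbT // vR vI.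
by exists u; rewrite !inE ?eqxx ?us ?orbT.
Qed.

(** Markov's inequality for the potential at threshold 2, where histories of probability zero are
    exempt. *)
Lemma ppush_prob_markov r (good : pred (history T)) :
  (forall h, size h = r -> law h != 0 -> ~~ good h -> 2 <= potential h) ->
  2^-1 <= ppush_prob K e adv I0 r good.
Proof.
move=> bad2.
have := ppush_prob_total K e adv I0 r; rewrite /ppush_prob (bigID (fun h : r.-tuple (proposals T) => good h)) /=.
suff : \sum_(h : r.-tuple (proposals T) | ~~ good h) law h <= 2^-1 by lra.
rewrite -(ler_pM2l (ltr0n K 2)) mulfV ?pnatr_eq0 // mulr_sumr.
apply: le_trans (potential_expectation r); rewrite [leRHS](bigID (fun h : r.-tuple (proposals T) => good h)) /=.
apply: ler_wpDl; first by apply: sumr_ge0 => h _; rewrite mulr_ge0 ?ppush_law_ge0 ?potential_ge0.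
apply: ler_sum => h hbad; rewrite mulrC.
have [->|hN0] := eqVneq (law h) 0; first by rewrite !mul0r.
by rewrite ler_wpM2l ?ppush_law_ge0 // bad2 ?size_tuple.
Qed.

End Process.

(** * Numerical estimates and conclusion *)

Lemma bernoulli (K : realDomainType) (x : K) n : 0 <= x -> 1 + n%:R * x <= (1 + x) ^+ n.
Proof.
move=> x0; elim: n => [|n IH]; first by rewrite mul0r addr0.
rewrite exprS; apply: (@le_trans _ _ ((1 + x) * (1 + n%:R * x))).
  rewrite -natr1; have : 0 <= n%:R * x * x by rewrite !mulr_ge0.
  by lra.
by rewrite ler_wpM2l // addr_ge0.
Qed.

Lemma potential_large (K : realType) (q : K) (m S N : nat) :
  0 < q -> q <= 1 -> 1 < 12^-1 * (m%:R * q) -> S%:R < 12^-1 * (m%:R * q) ->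
  (m <= S + N)%N -> 2 <= 2^-1 ^+ S * boost q ^+ N.
Proof.
move=> q0 q1 mq1 Smq mSN.
have iq0 : 0 < q^-1 by rewrite invr_gt0.
have iq1 : 1 <= q^-1 by rewrite invr_ge1 ?unitf_gt0 // gt_eqF.
(* [k] is the least integer above 2/q, so Bernoulli's inequality gives (1 + q/2)^k >= 2. *)
pose k := (Num.trunc (2 / q)).+1.
have /andP[k1 k2] : (Num.trunc (2 / q))%:R <= 2 / q < k%:R by rewrite truncn_itv // ltW // mulr_gt0.
have boostk : 2 <= boost q ^+ k.
  apply: (@le_trans _ _ ((1 + q / 2) ^+ k)); last first.
    by rewrite lerXn2r ?nnegrE ?boost_ge ?boost_ge0 // ltW //; lra.
  apply: le_trans (bernoulli _ _); last lra.
  by move: k2; rewrite ltr_pdivrMr //; lra.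
(* Here k <= 3/q and S + 1 <= mq/6, so k(S + 1) <= m/2, while S < m/12 leaves N >= m/2; the constant
   12 gives this room. *)
have kN : (k * S.+1 <= N)%N.
  rewrite -(ler_nat K) natrM.
  have kle : k%:R <= 3 / q by rewrite /k -natr1; lra.
  have mSNr : m%:R <= S%:R + N%:R :> K by rewrite -natrD ler_nat.
  have Smq2 : S.+1%:R <= 6^-1 * (m%:R * q) by rewrite -natr1; lra.
  apply: (@le_trans _ _ (3 / q * (6^-1 * (m%:R * q)))); first by apply: ler_pM.
  have -> : 3 / q * (6^-1 * (m%:R * q)) = m%:R / 2 by field; rewrite gt_eqF.
  have : m%:R * q <= m%:R by rewrite -[leRHS]mulr1 ler_wpM2l.
  by lra.
apply: (@le_trans _ _ (2^-1 ^+ S * 2 ^+ S.+1)).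
  by rewrite exprS mulrCA -exprMn mulVf ?pnatr_eq0 // expr1n mulr1.
rewrite ler_wpM2l ?exprn_ge0 ?invr_ge0 //.
apply: (@le_trans _ _ (boost q ^+ (k * S.+1))).
  by rewrite exprM lerXn2r ?nnegrE ?exprn_ge0 ?boost_ge0 // ltW.
by rewrite ler_weXn2l // boost_ge1 // ltW.
Qed.

Theorem theorem4 (K : realType) :
  exists p c : K, [/\ 0 < p, 0 < c &
    forall (T : finType) (G' G : rel T) (L R : {set T}) (m r : nat)
           (I0 : {set T}) (adv : adversary T),
      let n := #|T| in
      let Delta := max_degree G in
      simple_graph G' -> connected_graph G' ->
      bipartite_subgraph G G' L R ->
      (#|L| <= #|R|)%N -> #|L| = m ->
      (exists M : {set {set T}}, matching G M /\ #|M| = m) ->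
      L \subset I0 -> [disjoint R & I0] ->
      (forall x y, x \in L -> G' x y -> y \notin I0 -> y \in R) ->
      (1 <= r)%N -> r%:R <= log2 (Delta%:R : K) ->
      legal_adversary adv ->
      p <= ppush_prob K G' adv I0 r (fun h =>
             c * (m%:R * (Delta%:R `^ (- r%:R^-1)) / (r%:R * log2 n%:R))
               <= #|R :&: informed adv I0 h|%:R)].
Proof.
exists 2^-1, 12^-1; split; rewrite ?invr_gt0 ?ltr0n //.
move=> T G' G L R m r I0 adv n Delta _ _ [[Gsym _] [LR bip] sub sup] _ Lm.
move=> [M [[Medge Mdisj] Mm]] LI0 RI0 LR0 r1 rle adv_legal.
have l2 : 0 < ln (2 : K) by rewrite ln_gt0 // ltr1n.
have r1K : 1 <= r%:R :> K by rewrite ler1n.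
(* As [ln 0] is 0 by convention, Delta = 0 would give r <= 0. *)
have D0 : (0 < Delta)%N.
  rewrite lt0n; apply/eqP => D0; move: rle; rewrite D0 /log2 ln0 // mul0r; lra.
have logn : 1 <= log2 (n%:R : K).
  apply: le_trans r1K (le_trans rle _); rewrite /log2 ler_pM2r ?invr_gt0 //.
  have Dn : (Delta <= n)%N by apply/bigmax_leqP => x _; apply: max_card.
  by rewrite ler_ln ?posrE ?ler_nat ?ltr0n // (leq_trans D0).
pose q : K := Delta%:R `^ (- r%:R^-1).
have q0 : 0 < q by rewrite powR_gt0 ?ltr0n.
have q1 : q <= 1.
  rewrite /q powRN invf_le1 ?powR_gt0 ?ltr0n //.
  by rewrite -[leLHS](powRr0 (Delta%:R : K)) ler_powR ?ler1n // invr_ge0.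
have qD : q ^+ r * Delta%:R = 1.
  rewrite -powR_mulrn ?(ltW q0) // /q -powRrM mulNr mulVf ?pnatr_eq0 -?lt0n //.
  by rewrite powR_inv1 // mulVf ?pnatr_eq0 -?lt0n.
(* Uninformed neighbors in [G'] of a node of [L] lie in [R], so these edges belong to [G] and its
   maximum degree bounds their number. *)
have degree u : u \in L -> (#|ppush_targets G' I0 u| <= Delta)%N.
  move=> uL; apply: leq_trans (leq_bigmax u); apply/subset_leq_card/subsetP => v.
  rewrite !inE => /andP[G'uv vI]; apply: sup => //; exact: LR0 G'uv vI.
have edges E : E \in M -> exists u v, [/\ u \in L, v \in R, G' u v & E = [set u; v]].
  move=> /Medge[x [y [Gxy ->]]]; case/orP: (bip x y Gxy) => /andP[xA yB].
    by exists x, y; split=> //; apply: sub.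
  by exists y, x; split=> //; [apply: sub; rewrite Gsym | rewrite setUC].
apply: (ppush_prob_markov (ltW q0) q1 LI0 RI0 LR0 adv_legal) => h hr lawN0.
rewrite -ltNge -/q => few.
have h0 : (0 < size h)%N by rewrite hr.
have {few} few : #|R :&: informed adv I0 h|%:R < 12^-1 * (m%:R * q).
  apply: lt_le_trans few _; rewrite ler_wpM2l ?invr_ge0 //.
  rewrite ler_pdivrMr; last by rewrite mulr_gt0 //; lra.
  by rewrite ler_peMr ?mulr_ge0 ?(ltW q0) // mulr_ege1.
(* The strict bound [few] forces m > 0, so the matching has an edge and some node of [R] is
   informed; then 1 <= S < mq/12 supplies the hypothesis 1 < mq/12 of [potential_large]. *)
have M0 : (0 < #|M|)%N.
  rewrite Mm lt0n; apply/eqP => m0; move: few; rewrite m0 mul0r mulr0 ltNge.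
  by rewrite ler0n.
have [E EM] : exists E, E \in M by apply/card_gt0P.
have [u [v [uL vR G'uv _]]] := edges E EM.
have some := some_informed LI0 LR0 adv_legal uL vR G'uv h0 lawN0.
apply: (@potential_large _ _ m) => //.
  by apply: le_lt_trans few; rewrite ler1n.
rewrite -Mm; apply: (matching_bound (e := G') (L := L)) => //; first exact: ltW.
move=> w wL; rewrite hr -[leRHS]qD; apply: ler_wpM2l.
  by rewrite exprn_ge0 ?(ltW q0).
by rewrite ler_nat degree.
Qed.
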